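(* Let $H$ be a real Hilbert space and let $B: H\to H$ be a monotone (possibly nonlinear), hemicontinuous operator defined on all of $H$. Let $\epsilon>0$ be a constant and let $w_0\in H$ be arbitrary. Then the Cauchy problem $$\dot w=-B(w)-\epsilon w,\qquad w(0)=w_0,$$ has a unique global solution $w(t)$ (defined for all $t\ge 0$), the strong limit $w(\infty):=\lim_{t\to\infty}w(t)$ exists in $H$, and $w(\infty)$ solves the equation $B(v)+\epsilon v=0$, i.e. $B(w(\infty))+\epsilon\, w(\infty)=0$.
   Context: $(\cdot,\cdot)$ and $\|\cdot\|$ denote the inner product and norm of $H$. $B$ is monotone if $(B(u)-B(v),u-v)\ge 0$ for all $u,v\in H$. $B$ is hemicontinuous if for all $u,v,z\in H$ the function $s\mapsto (B(u+sv),z)$ is continuous on $\mathbb{R}$. The dot denotes the derivative with respect to $t$. Since $B$ is only hemicontinuous, the derivative in the Cauchy problem is understood in the weak sense: a global solution is a (strongly) continuous function $w:[0,\infty)\to H$ with $w(0)=w_0$ such that for every $z\in H$ the function $t\mapsto (w(t),z)$ is differentiable with derivative $-(B(w(t))+\epsilon w(t),z)$ for all $t\ge 0$ (one-sided at $t=0$). *)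

(* Defs.v *)
From HB Require Import structures.
From mathcomp Require Import all_boot all_order all_algebra.
From mathcomp Require Import all_classical all_reals all_analysis.

Set Implicit Arguments.
Unset Strict Implicit.
Unset Printing Implicit Defensive.

Import Order.TTheory GRing.Theory Num.Theory.
Import numFieldNormedType.Exports.

Local Open Scope classical_set_scope.
Local Open Scope ring_scope.

(* A real Hilbert space is a complete normed module over R : realType together
   with a positive definite symmetric bilinear form, {dot H for idfun}, whose
   quadratic form is the square of the norm of H. *)
Definition induces_norm (R : realType) (H : completeNormedModType R)
    (ip : {dot H for idfun}) : Prop :=
  forall u : H, `|u| ^+ 2 = ip u u.

Definition monotone_operator (R : realType) (H : completeNormedModType R)
    (ip : {dot H for idfun}) (B : H -> H) : Prop :=
  forall u v : H, 0 <= ip (B u - B v) (u - v).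

Definition hemicontinuous (R : realType) (H : completeNormedModType R)
    (ip : {dot H for idfun}) (B : H -> H) : Prop :=
  forall u v z : H, continuous (fun s : R => ip (B (u + s *: v)) z).

(* w is defined on the whole line, but only its values on [0, +oo[ matter: the
   continuity is relative to [0, +oo[ and the derivative at 0 is one-sided. *)
Definition global_weak_solution (R : realType) (H : completeNormedModType R)
    (ip : {dot H for idfun}) (B : H -> H) (eps : R) (w0 : H) (w : R -> H) :
    Prop :=
  [/\ w 0 = w0,
      {within `[0, +oo[, continuous w},
      forall (z : H) (t : R), 0 < t ->
        is_derive t 1 (fun s : R => ip (w s) z)
                      (- ip (B (w t) + eps *: w t) z)
    & forall z : H,
        h^-1 * (ip (w h) z - ip (w 0) z) @[h --> 0^'+] -->
          - ip (B (w 0) + eps *: w 0) z].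

(* Main.v *)
Require Import Defs.
From HB Require Import structures.
From mathcomp Require Import all_boot all_order all_algebra.
From mathcomp Require Import all_classical all_reals all_analysis.
From mathcomp Require Import ring lra.

Set Implicit Arguments.
Unset Strict Implicit.
Unset Printing Implicit Defensive.

Import Order.TTheory GRing.Theory Num.Theory.
Import numFieldNormedType.Exports.

Local Open Scope classical_set_scope.
Local Open Scope ring_scope.

(** The solution is built directly, without solving any resolvent equation. A
    monotone operator defined everywhere is locally bounded (uniform boundedness
    principle), hence, being hemicontinuous, it is continuous from the strong to
    the weak topology. For A = B + eps, monotonicity makes explicit Euler schemes
    with dyadic steps Cauchy for as long as A stays bounded along them, and
    strong-weak continuity of A identifies the limit as a weak solution. If
    boundedness first failed at a finite time T, contractivity of the flow would
    make the solution uniformly continuous on [0, T[; local boundedness of A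
    around its limit at T would then carry the schemes past T.

    Strong monotonicity gives |w t - v t| <= exp(- eps t) |w 0 - v 0| for any two
    solutions, hence uniqueness. The fixed point p of the time-one map is then
    stationary, so A p = 0, and every solution converges to p. *)

(** Derivatives below come from remainder estimates without division; this converts such an estimate
    into the difference-quotient form. *)
Lemma is_derive1_bound (R : realType) (f : R -> R) (t l : R) :
  (forall e, 0 < e -> \forall s \near t,
     `|f s - f t - (s - t) * l| <= e * `|s - t|) ->
  is_derive t 1 f l.
Proof.
move=> flP.
have cvl : h^-1 *: ((f \o shift t) (h *: (1 : R)) - f t) @[h --> 0^'] --> l.
  apply/cvgrPdist_le => e /flP/nbhs_ballP[d /= d0 dP].
  exists d => //= h /= hd h0.
  rewrite sub0r normrN in hd; rewrite scaler1.
  have : ball t d (h + t) by rewrite /ball/= opprD addrCA subrr addr0 normrN.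
  move=> /dP; rewrite addrK => le; rewrite distrC.
  rewrite -(ler_pM2l (x := `|h|)) ?normr_gt0// -normrM mulrBr.
  by rewrite /GRing.scale/= mulVKf// mulrC (mulrC _ e) (mulrC l).
by apply: DeriveDef; [apply/cvg_ex; exists l|exact/cvg_lim].
Qed.

(** * Inner product identities and duality *)

Section InnerProduct.
Context {R : realType} {H : completeNormedModType R} (ip : {dot H for idfun}).
Hypothesis ip_norm : induces_norm ip.

Lemma ipC u v : ip u v = ip v u.
Proof. by rewrite hermC expr0 mul1r. Qed.

Lemma ipDl u v w : ip (u + v) w = ip u w + ip v w.
Proof. exact: linearDl. Qed.

Lemma ipDr u v w : ip w (u + v) = ip w u + ip w v.
Proof. exact: linearDr. Qed.

Lemma ipNl u w : ip (- u) w = - ip u w.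
Proof. exact: linearNl. Qed.

Lemma ipNr u w : ip w (- u) = - ip w u.
Proof. exact: linearNr. Qed.

Lemma ipZl a u w : ip (a *: u) w = a * ip u w.
Proof. exact: linearZl_LR. Qed.

Lemma ipZr a u w : ip w (a *: u) = a * ip w u.
Proof. exact: linearZr_LR. Qed.

Lemma ip0l u : ip 0 u = 0.
Proof. exact: linear0l. Qed.

Lemma ip0r u : ip u 0 = 0.
Proof. exact: linear0r. Qed.

Definition ipE := (ipDl, ipDr, ipNl, ipNr, ipZl, ipZr).

Lemma sqr_normD (u v : H) : `|u + v| ^+ 2 = `|u| ^+ 2 + 2 * ip u v + `|v| ^+ 2.
Proof. by rewrite !ip_norm !ipE (ipC v u); ring. Qed.

Lemma sqr_normB (u v : H) : `|u - v| ^+ 2 = `|u| ^+ 2 - 2 * ip u v + `|v| ^+ 2.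
Proof. by rewrite !ip_norm !ipE (ipC v u); ring. Qed.

Lemma sqr_normD_le (u v : H) : `|u + v| ^+ 2 <= 2 * `|u| ^+ 2 + 2 * `|v| ^+ 2.
Proof.
by have := sqr_ge0 `|u - v|; rewrite sqr_normB sqr_normD; lra.
Qed.

Lemma ip_le_norm u v : ip u v <= `|u| * `|v|.
Proof.
have [->|u0] := eqVneq u 0.
  by rewrite ip0l normr0 mul0r.
have [->|v0] := eqVneq v 0.
  by rewrite ip0r normr0 mulr0.
(* Expanded, this square factors with [|u| * |v| - ip u v] as its only factor of unknown sign. *)
have: 0 <= `| `|v| *: u - `|u| *: v| ^+ 2 by exact: sqr_ge0.
rewrite sqr_normB !normrZ !normr_id !ipE.
rewrite -normr_gt0 in u0; rewrite -normr_gt0 in v0.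
rewrite (_ : _ + _ = 2 * (`|u| * `|v|) * (`|u| * `|v| - ip u v)); last by ring.
by rewrite pmulr_rge0 ?subr_ge0// !mulr_gt0.
Qed.

Lemma ip_abs_le_norm u v : `|ip u v| <= `|u| * `|v|.
Proof.
by rewrite ler_norml ip_le_norm andbT lerNl -ipNl -(normrN u) ip_le_norm.
Qed.

(** Test with [z = u]. This is how weak estimates are turned into norm estimates. *)
Lemma norm_le_dual u (c : R) :
  0 <= c -> (forall z, ip u z <= c * `|z|) -> `|u| <= c.
Proof.
move=> c0 /(_ u); rewrite -ip_norm expr2.
have [->|] := eqVneq u 0; first by rewrite normr0.
by rewrite -normr_gt0 => u0; rewrite ler_pM2r.
Qed.

Lemma cvg_ip (T : Type) (F : set_system T) (FF : Filter F) (f : T -> H) l z :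
  f x @[x --> F] --> l -> ip (f x) z @[x --> F] --> ip l z.
Proof.
move=> fl; suff: `|ip (f x) z - ip l z| @[x --> F] --> (0 : R).
  by move=> h; apply/subr_cvg0; exact: norm_cvg0.
apply: (@squeeze_cvgr _ F FF R (fun=> 0) (fun x => `|f x - l| * `|z|)).
- by near=> x; rewrite normr_ge0 -ipNl -ipDl ip_abs_le_norm.
- exact: cvg_cst.
- by rewrite -(mul0r `|z|) -(normr0 H); apply: cvgMl; apply: cvg_norm; exact/subr_cvg0.
Unshelve. all: end_near. Qed.

(** * Monotone operators: local boundedness, strong-weak continuity, refinement of Euler steps *)

Section MonotoneOperator.
Variable A : H -> H.
Hypothesis A_mono : monotone_operator ip A.

(* The functionals [ip (A y)] divided by [1 + |A y| |y - x|], for [y] near [x],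
   are pointwise bounded by monotonicity, hence uniformly bounded. *)
Lemma monotone_locally_bounded x :
  exists r c : R, 0 < r /\ forall y, `|y - x| <= r -> `|A y| <= c.
Proof.
pose w y : R := 1 + `|A y| * `|y - x|.
have w_gt0 y : 0 < w y by rewrite ltr_pwDl// mulr_ge0.
pose F : set (H -> R^o) :=
  [set f | exists2 y, `|y - x| <= 1 & f = fun v => (w y)^-1 * ip (A y) v].
have upper v : exists M : R, forall y, `|y - x| <= 1 -> ip (A y) v <= w y * M.
  exists (1 + `|A (x + v)| * (1 + `|v|)) => y yx1.
  (* Monotonicity bounds [ip (A y) v] by [ip (A y) (y - x)], at most [w y], plus a term independent
     of [A y], absorbed because [w y] is at least 1. *)
  have := A_mono y (x + v).
  rewrite opprD addrA !ipE => mono.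
  have b1 : ip (A y) y - ip (A y) x <= w y.
    by rewrite -ipNr -ipDr (le_trans (ip_le_norm _ _))// lerDr.
  have b2 : - (ip (A (x + v)) y - ip (A (x + v)) x - ip (A (x + v)) v) <=
      `|A (x + v)| * (1 + `|v|).
    rewrite -ipNr -ipDr -ipNr -ipDr -ipNl (le_trans (ip_le_norm _ _))// normrN.
    by rewrite ler_wpM2l// (le_trans (ler_normB _ _))// lerD2r.
  have : `|A (x + v)| * (1 + `|v|) <= w y * (`|A (x + v)| * (1 + `|v|)).
    by rewrite ler_peMl ?mulr_ge0 ?addr_ge0// lerDl mulr_ge0.
  by rewrite mulrDr mulr1; lra.
have bounded_linear f : F f -> bounded_fun_norm f /\ linear f.
  move=> [y _ ->]; split=> [r|a u v]; last first.
    by rewrite !ipE /GRing.scale/=; ring.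
  exists ((w y)^-1 * (`|A y| * r)) => v vr.
  rewrite normrM gtr0_norm ?invr_gt0// ler_pM2l ?invr_gt0//.
  by rewrite (le_trans (ip_abs_le_norm _ _))// ler_wpM2l.
have pointwise : pointwise_bounded F.
  move=> v; have [M1 M1P] := upper v; have [M2 M2P] := upper (- v).
  exists (Num.max M1 M2) => f [y yx1 ->].
  rewrite normrM gtr0_norm ?invr_gt0// ler_pdivrMl//.
  have := M1P _ yx1; have := M2P _ yx1; rewrite ipNr => le2 le1.
  rewrite ler_norml lerNl; apply/andP; split.
    by rewrite (le_trans le2)// ler_pM2l// le_max lexx orbT.
  by rewrite (le_trans le1)// ler_pM2l// le_max lexx.
have [M MP] := Banach_Steinhauss bounded_linear pointwise 1.
pose C := Num.max M 1.
have C_gt0 : 0 < C by rewrite lt_max ltr01 orbT.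
have C_ge1 : 1 <= C by rewrite le_max lexx orbT.
(* On this radius [|A y| <= C * w y] reads [|A y| <= C + |A y| / 2], and the last term is absorbed
   on the left. *)
exists (2 * C)^-1, (2 * C); split=> [|y yx]; first by rewrite invr_gt0 mulr_gt0.
have yx1 : `|y - x| <= 1.
  by rewrite (le_trans yx)// invf_le1 ?mulr_gt0//; lra.
have Ay_le : `|A y| <= C * w y.
  apply: norm_le_dual => [|z]; first by rewrite mulr_ge0 ?(ltW C_gt0) ?(ltW (w_gt0 _)).
  have [->|z0] := eqVneq z 0.
    by rewrite normr0 mulr0 ip0r.
  rewrite -normr_gt0 in z0.
  have := MP _ (ex_intro2 _ _ y yx1 erefl) (`|z|^-1 *: z).
  rewrite normrZ normfV normr_id mulVf ?gt_eqF// lexx => /(_ isT).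
  rewrite ipE => /(le_trans (ler_norm _)).
  rewrite ler_pdivrMl// ler_pdivrMl// => /le_trans; apply.
  rewrite mulrC ler_pM2r// mulrC ler_pM2r//.
  by rewrite le_max lexx.
have : C * (`|A y| * `|y - x|) <= C * (`|A y| * (2 * C)^-1).
  by rewrite ler_pM2l// ler_wpM2l.
rewrite (_ : C * (_ / _) = `|A y| / 2); last by field; rewrite gt_eqF.
by move: Ay_le; rewrite /w; lra.
Qed.

Hypothesis A_hemi : hemicontinuous ip A.

(* Minty's trick: test monotonicity against [x + s *: z], divide by [s] and let
   [s] tend to 0. *)
Lemma monotone_demicontinuous x z (e : R) : 0 < e ->
  exists2 d : R, 0 < d & forall y, `|y - x| < d -> `|ip (A y - A x) z| <= e.
Proof.
move=> e0.
have one_sided z' : exists2 d : R,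
    0 < d & forall y, `|y - x| < d -> ip (A y - A x) z' <= e.
  have [r [c [r0 Ac]]] := monotone_locally_bounded x.
  have c0 : 0 <= c by rewrite (le_trans _ (Ac x _))// subrr normr0 ltW.
  have [s s0 As] : exists2 s : R,
      0 < s & ip (A (x + s *: z')) z' <= ip (A x) z' + e / 2.
    have /cvgrPdist_le/(_ (e / 2)) := @A_hemi x z' z' 0.
    rewrite divr_gt0// => /(_ isT) /nbhs_ballP[d /= d0 dP].
    exists (d / 2); first by rewrite divr_gt0.
    have /dP : ball 0 d (d / 2).
      by rewrite /ball/= sub0r normrN gtr0_norm ?divr_gt0//; lra.
    by rewrite scale0r addr0 distrC => /ler_normlW; rewrite lerBlDl.
  pose K := c + `|A (x + s *: z')| + 1.
  have K0 : 0 < K by rewrite ltr_wpDl// addr_ge0.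
  (* The second entry gives [|y - x| * K < s * (e / 2)]; after division by [s] this is one half of
     the error, the choice of [s] being the other. *)
  exists (Num.min r (s * (e / 2) / K)).
    by rewrite lt_min r0 !mulr_gt0// invr_gt0.
  move=> y; rewrite lt_min => /andP[/ltW/Ac Ayc].
  rewrite ltr_pdivlMr// => yx.
  have := A_mono y (x + s *: z').
  rewrite opprD addrA ipDr ipNr ipZr => mono.
  have : ip (A y - A (x + s *: z')) (y - x) <= `|y - x| * K.
    rewrite (le_trans (ip_le_norm _ _))// mulrC ler_wpM2l//.
    by rewrite (le_trans (ler_normB _ _))// /K; lra.
  move=> le1.
  have : s * ip (A y - A (x + s *: z')) z' <= s * (e / 2) by lra.
  rewrite ler_pM2l// !ipE; lra.
have [d1 d10 d1P] := one_sided z; have [d2 d20 d2P] := one_sided (- z).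
exists (Num.min d1 d2); first by rewrite lt_min d10.
move=> y; rewrite lt_min => /andP[/d1P le1 /d2P].
by rewrite ipNr ler_norml le1 andbT lerNl.
Qed.
(* [x] and [y] are Euler schemes with steps [M g] and [g]; the coarse one is
   interpolated linearly at the fine times. Each fine step adds to the squared
   distance at most the cross term due to interpolation, [4 c^2 g^2 M], plus
   [4 c^2 g^2]. *)
Lemma euler_refine (x y : nat -> H) (g c : R) (M J : nat) :
  0 <= g -> x 0%N = y 0%N ->
  (forall k, x k.+1 = x k - (M%:R * g) *: A (x k)) ->
  (forall j, y j.+1 = y j - g *: A (y j)) ->
  (forall k, (k * M <= J)%N -> `|A (x k)| <= c) ->
  (forall j, (j <= J)%N -> `|A (y j)| <= c) ->
  forall k i, (i <= M)%N -> (k * M + i <= J)%N ->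
  `|x k - (i%:R * g) *: A (x k) - y (k * M + i)%N| ^+ 2 <=
    8 * c ^+ 2 * g ^+ 2 * M%:R * (k * M + i)%:R.
Proof.
move=> g0 xy0 xS yS xc yc.
have c0 : 0 <= c by rewrite (le_trans _ (yc 0%N _)).
have step k i : (i < M)%N -> (k * M + i < J)%N ->
    `|x k - (i%:R * g) *: A (x k) - y (k * M + i)%N| ^+ 2 <=
      8 * c ^+ 2 * g ^+ 2 * M%:R * (k * M + i)%:R ->
    `|x k - (i.+1%:R * g) *: A (x k) - y (k * M + i.+1)%N| ^+ 2 <=
      8 * c ^+ 2 * g ^+ 2 * M%:R * (k * M + i.+1)%:R.
  rewrite addnS yS => iM iJ.
  set a := x k; set b := y _ => IH.
  have ac : `|A a| <= c by apply: xc; rewrite (leq_trans _ (ltnW iJ))// leq_addr.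
  have bc : `|A b| <= c by apply: yc; exact: ltnW.
  (* One fine step changes the error by [- g *: (A a - A b)]. In the cross term, the part along
     [a - b] has the good sign by monotonicity; only the interpolation part [(i%:R * g) *: A a] must
     be estimated. *)
  rewrite (_ : _ - _ = a - (i%:R * g) *: A a - b - g *: (A a - A b)); last first.
    rewrite -natr1 mulrDl mul1r scalerDl scalerBr !opprD !opprK !addrA.
    by rewrite (addrAC (a - _) _ (- b)).
  rewrite sqr_normB normrZ exprMn (ger0_norm g0) ipZr.
  have abc : `|A a - A b| <= 2 * c by rewrite (le_trans (ler_normB _ _))//; lra.
  have g2 : 0 <= g ^+ 2 by exact: sqr_ge0.
  have c2 : 0 <= c ^+ 2 by exact: sqr_ge0.
  have M1 : (1 : R) <= M%:R by rewrite ler1n (leq_ltn_trans _ iM).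
  have cross : - (M%:R * g * (2 * c ^+ 2)) <=
      ip (a - (i%:R * g) *: A a - b) (A a - A b).
    rewrite addrAC ipDl ipNl ipZl (ipC (a - b)).
    have : ip (A a) (A a - A b) <= 2 * c ^+ 2.
      by rewrite (le_trans (ip_le_norm _ _))// (_ : 2 * _ = c * (2 * c)) ?ler_pM//; ring.
    move=> /(ler_wpM2l (mulr_ge0 (ler0n R i) g0)).
    have : i%:R * g * (2 * c ^+ 2) <= M%:R * g * (2 * c ^+ 2).
      by rewrite ler_wpM2r ?mulr_ge0// ler_wpM2r// ler_nat ltnW.
    by have := A_mono a b; lra.
  have sq : g ^+ 2 * `|A a - A b| ^+ 2 <= M%:R * (g ^+ 2 * (4 * c ^+ 2)).
    rewrite (@le_trans _ _ (g ^+ 2 * (4 * c ^+ 2)))//; last first.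
      by rewrite ler_peMl// !mulr_ge0.
    rewrite ler_wpM2l// (_ : 4 * _ = (2 * c) ^+ 2); last by rewrite exprMn; congr (_ * _); ring.
    by rewrite !expr2 ler_pM.
  have := ler_wpM2l g0 cross.
  by rewrite -(natr1 (_ + i)%N) mulrDr mulr1; lra.
have row k : `|x k - y (k * M)%N| ^+ 2 <=
      8 * c ^+ 2 * g ^+ 2 * M%:R * (k * M)%:R ->
    forall i, (i <= M)%N -> (k * M + i <= J)%N ->
    `|x k - (i%:R * g) *: A (x k) - y (k * M + i)%N| ^+ 2 <=
      8 * c ^+ 2 * g ^+ 2 * M%:R * (k * M + i)%:R.
  move=> IH; elim=> [|i IHi] iM iJ; first by rewrite mul0r scale0r subr0 addn0.
  by apply: step => //; [rewrite -addnS|apply: IHi; rewrite ltnW// -addnS].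
elim=> [|k IHk] i iM iJ; apply: row => //.
  by rewrite mul0n xy0 subrr normr0 expr0n mulr0.
(* The right end [i = M] of row [k] is the left end of row [k.+1]. *)
have := IHk M (leqnn _); rewrite -xS addnC -mulSn; apply.
by rewrite (leq_trans _ iJ)// leq_addr.
Qed.

(** * Dyadic Euler schemes and their convergence *)

Definition euler w0 n k : H := iter k (fun x => x - 2 ^- n *: A x) w0.

(** The value at the last grid time before [t]. Truncation sends negative times to index 0, so the
    curve is extended by [w0] to the left. *)
Definition euler_at w0 n (t : R) : H := euler w0 n (Num.truncn (t * 2 ^+ n)).

Definition euler_lim w0 (t : R) : H := lim (euler_at w0 n t @[n --> \oo]).

(** The condition under which the schemes converge up to time [T]; the continuation argument shows
    that it never fails. *)
Definition euler_bounded w0 (T : R) := exists N c, forall n k,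
  (N <= n)%N -> k%:R <= T * 2 ^+ n -> `|A (euler w0 n k)| <= c.

(** The increments telescope. Taking [p = 0] bounds the displacement; taking [p] to be the expected
    value of [ip (A _) z] yields the weak derivative. *)
Lemma euler_ip_increment w0 n k m z (p e : R) :
  (forall j, (k <= j < k + m)%N -> `|ip (A (euler w0 n j)) z - p| <= e) ->
  `|ip (euler w0 n (k + m) - euler w0 n k) z + m%:R * 2 ^- n * p| <=
    m%:R * 2 ^- n * e.
Proof.
elim: m => [|m IH] bound.
  by rewrite addn0 subrr ip0l !mul0r addr0 normr0.
have := bound (k + m)%N; rewrite leq_addr addnS ltnSn => /(_ isT) le1.
have {}/IH le2 j : (k <= j < k + m)%N -> `|ip (A (euler w0 n j)) z - p| <= e.
  by move=> /andP[kj jm]; apply: bound; rewrite kj addnS ltnW.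
rewrite [euler w0 n _.+1]iterS -/(euler w0 n _) addrAC ipDl ipNl ipZl.
rewrite (_ : _ + _ = ip (euler w0 n (k + m) - euler w0 n k) z +
    m%:R * 2 ^- n * p - 2 ^- n * (ip (A (euler w0 n (k + m))) z - p)); last first.
  by rewrite -(natr1 m); ring.
rewrite (le_trans (ler_normB _ _))// -(natr1 m) 2!mulrDl mul1r lerD// normrM.
by rewrite ger0_norm ?invr_ge0 ?exprn_ge0// ler_wpM2l// invr_ge0 exprn_ge0.
Qed.

Lemma euler_increment w0 n k l (c : R) : 0 <= c ->
  (forall j, (j < maxn k l)%N -> `|A (euler w0 n j)| <= c) ->
  `|euler w0 n l - euler w0 n k| <= `|l%:R - k%:R| * 2 ^- n * c.
Proof.
move=> c0; wlog kl : k l / (k <= l)%N => [wl bound|].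
  have [kl|/ltnW lk] := leqP k l; first exact: wl.
  by rewrite distrC (distrC l%:R) wl// maxnC.
rewrite (maxn_idPr kl) ger0_norm ?subr_ge0 ?ler_nat// => bound.
apply: norm_le_dual => [|z].
  by rewrite !mulr_ge0 ?invr_ge0 ?exprn_ge0// subr_ge0 ler_nat.
rewrite (le_trans (ler_norm _))//.
have := @euler_ip_increment w0 n k (l - k) z 0 (c * `|z|).
rewrite subnKC// mulr0 addr0 natrB// !mulrA; apply=> j /andP[_ /bound Aj].
by rewrite subr0 (le_trans (ip_abs_le_norm _ _))// ler_wpM2r.
Qed.

Lemma truncn_pow2_itv n (t : R) : 0 <= t ->
  t - 2 ^- n <= (Num.truncn (t * 2 ^+ n))%:R * 2 ^- n <= t.
Proof.
move=> t0; have n0 : (0 : R) < 2 ^+ n by rewrite exprn_gt0.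
have /andP[le lt] := truncn_itv (mulr_ge0 t0 (ltW n0)).
rewrite ler_pdivrMr// le andbT -(ler_pM2r n0) mulrBl mulfVK ?gt_eqF// mulVf ?gt_eqF//.
by rewrite lerBlDr natr1 ltW.
Qed.

Lemma euler_at_increment w0 n (s t c : R) : 0 <= s <= t -> 0 <= c ->
  (forall k, k%:R <= t * 2 ^+ n -> `|A (euler w0 n k)| <= c) ->
  `|euler_at w0 n t - euler_at w0 n s| <= (t - s + 2 ^- n) * c.
Proof.
move=> /andP[s0 st] c0 bound.
have /andP[s1 s2] := truncn_pow2_itv n s0.
have /andP[t1 t2] := truncn_pow2_itv n (le_trans s0 st).
have kl : (Num.truncn (s * 2 ^+ n) <= Num.truncn (t * 2 ^+ n))%N.
  by apply: le_truncn; rewrite ler_wpM2r// exprn_ge0.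
rewrite (le_trans (euler_increment c0 _))//.
  move=> j; rewrite (maxn_idPr kl) => jt; apply: bound.
  rewrite -truncn_ge_nat ?(ltnW jt)// mulr_ge0 ?exprn_ge0//.
  exact: le_trans st.
by rewrite ger0_norm ?subr_ge0 ?ler_nat// ler_wpM2r// mulrBl; lra.
Qed.

Lemma pow2_cvg0 : (2 ^- n : R) @[n --> \oo] --> (0 : R).
Proof.
apply/cvgr0Pnorm_le => e e0; near=> n.
rewrite ger0_norm ?invr_ge0 ?exprn_ge0// -[leLHS]mul1r ltW//.
by near: n; exact: (near_infty_natSinv_expn_lt (PosNum e0)).
Unshelve. all: end_near. Qed.

(** [euler_refine] with [M = 2 ^ m] compares the fine scheme with the interpolated coarse one, with
    squared error at most [8 * T * c ^+ 2 * 2 ^- n]. Removing the interpolation costs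
    [c ^+ 2 * 2 ^- n], and adding the two errors doubles both squares. *)
Lemma euler_at_dist w0 n m (t T c : R) : 0 <= t <= T ->
  (forall k, k%:R <= T * 2 ^+ n -> `|A (euler w0 n k)| <= c) ->
  (forall k, k%:R <= T * 2 ^+ (n + m) -> `|A (euler w0 (n + m) k)| <= c) ->
  `|euler_at w0 (n + m) t - euler_at w0 n t| ^+ 2 <=
    (16 * T + 2) * c ^+ 2 * 2 ^- n.
Proof.
move=> /andP[t0 tT] bound1 bound2.
have T0 := le_trans t0 tT.
have n0 : (0 : R) < 2 ^+ n by rewrite exprn_gt0.
have m0 : (0 : R) < 2 ^+ m by rewrite exprn_gt0.
have nm0 : (0 : R) < 2 ^+ (n + m) by rewrite exprn_gt0.
rewrite /euler_at; set k := Num.truncn (t * 2 ^+ n).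
set J := Num.truncn (t * 2 ^+ (n + m)).
have tn0 : 0 <= t * 2 ^+ n by rewrite mulr_ge0 ?(ltW n0).
have tnm0 : 0 <= t * 2 ^+ (n + m) by rewrite mulr_ge0 ?(ltW nm0).
(* The fine index [J] falls inside the coarse step number [k]. *)
have kJ : (k * 2 ^ m <= J)%N.
  rewrite truncn_ge_nat// natrM natrX exprD mulrA ler_pM2r//.
  by rewrite truncn_le.
have Jk : (J < k * 2 ^ m + 2 ^ m)%N.
  rewrite addnC -mulSn truncn_lt_nat// natrM natrX exprD mulrA ltr_pM2r//.
  by have /andP[] := truncn_itv tn0.
have hM : (2 ^ m)%N%:R * 2 ^- (n + m) = 2 ^- n :> R.
  by rewrite natrX exprD invfM mulrCA divff ?mulr1// gt_eqF.
have := @euler_refine (euler w0 n) (euler w0 (n + m)) (2 ^- (n + m)) c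
  (2 ^ m) J _ erefl _ _ _ _ k (J - k * 2 ^ m).
rewrite hM invr_ge0 (ltW nm0) subnKC//.
have JT j : (j <= J)%N -> j%:R <= T * 2 ^+ (n + m).
  rewrite truncn_ge_nat// => /le_trans; apply.
  by rewrite ler_wpM2r// ltW.
have kT j : (j * 2 ^ m <= J)%N -> j%:R <= T * 2 ^+ n.
  by move=> /JT; rewrite natrM natrX exprD mulrA ler_pM2r.
have iM : (J - k * 2 ^ m <= 2 ^ m)%N by rewrite leq_subLR ltnW.
move=> /(_ isT (fun=> erefl) (fun=> erefl)) /(_ _ _ iM (leqnn _)) dist.
have {}dist := dist (fun j jJ => bound1 j (kT j jJ)) (fun j jJ => bound2 j (JT j jJ)).
set g : R := 2 ^- (n + m) in hM dist *; set i := (J - k * 2 ^ m)%N in iM dist *.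
set h : R := 2 ^- n in hM *; set a := euler w0 n k in dist *.
have g0 : 0 <= g by rewrite invr_ge0 ltW.
have h0 : 0 <= h by rewrite invr_ge0 ltW.
have ac : `|A a| <= c by apply: bound1; apply: kT.
have c2 : 0 <= c ^+ 2 by exact: sqr_ge0.
have Jg : J%:R * g <= T.
  by rewrite ler_pdivrMr// (le_trans _ (ler_wpM2r (ltW nm0) tT))// truncn_le.
have ig : i%:R * g <= h by rewrite -hM ler_wpM2r// ler_nat.
have h1 : h <= 1 by rewrite invf_le1// exprn_ege1// ler1n.
rewrite distrC (_ : _ - _ = a - (i%:R * g) *: A a - euler w0 (n + m) J +
    (i%:R * g) *: A a); last by rewrite addrAC subrK.
rewrite (le_trans (sqr_normD_le _ _))//.
have : `|(i%:R * g) *: A a| ^+ 2 <= c ^+ 2 * h.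
  rewrite normrZ exprMn ger0_norm ?mulr_ge0// mulrC ler_pM ?sqr_ge0//.
    by rewrite !expr2 ler_pM.
  by rewrite (@le_trans _ _ (h * h))// ?ler_piMl// expr2 ler_pM ?mulr_ge0.
have : 8 * c ^+ 2 * g ^+ 2 * (2 ^ m)%:R * J%:R <= 8 * c ^+ 2 * h * T.
  rewrite (_ : _ * J%:R = 8 * c ^+ 2 * ((2 ^ m)%:R * g) * (J%:R * g)); last by ring.
  by rewrite hM ler_wpM2l// mulr_ge0// mulr_ge0.
by move: dist; lra.
Qed.

Lemma euler_at_cvg w0 (T t : R) : euler_bounded w0 T -> 0 <= t <= T ->
  euler_at w0 n t @[n --> \oo] --> euler_lim w0 t.
Proof.
move=> [N [c bound]] tT; apply/cauchy_cvgP; apply: cauchy_exP => e e0.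
(* The added 1 keeps the divisor positive when [c = 0]; the further division by 2 below makes the
   final inequality strict. *)
have K0 : 0 < (16 * T + 2) * c ^+ 2 + 1.
  case/andP: tT => t0 tT; have T0 := le_trans t0 tT.
  by rewrite ltr_wpDl// mulr_ge0 ?sqr_ge0// addr_ge0// mulr_ge0.
have /cvgr0Pnorm_le/(_ (e ^+ 2 / ((16 * T + 2) * c ^+ 2 + 1) / 2)) := pow2_cvg0.
rewrite !divr_gt0 ?exprn_gt0// => /(_ isT)[N' _ N'P].
pose M := maxn N N'; exists (euler_at w0 M t).
exists M => // n /= Mn; rewrite -ball_normE/= distrC.
have NM : (N <= M)%N by exact: leq_maxl.
have := euler_at_dist (n := M) (m := n - M) tT (fun k => bound M k NM).
rewrite subnKC// => /(_ (fun k => bound n k (leq_trans NM Mn))) dist.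
have := N'P M (leq_maxr _ _).
rewrite /= ger0_norm ?invr_ge0 ?exprn_ge0// mulrAC ler_pdivlMr// => small.
rewrite -(@ltr_pXn2r _ 2)// ?nnegrE ?(ltW e0)// (le_lt_trans dist)//.
rewrite (@le_lt_trans _ _ (e ^+ 2 / 2))//; last first.
  by rewrite gtr_pMr ?exprn_gt0// invf_lt1// ltr1n.
rewrite (le_trans _ small)// mulrC ler_wpM2l ?invr_ge0 ?exprn_ge0//.
by rewrite lerDl.
Qed.

(** * Increments of the Euler limit *)

Lemma euler_lim_le0 w0 (t : R) : t <= 0 -> euler_lim w0 t = w0.
Proof.
move=> t0; rewrite /euler_lim (_ : (fun n => _) = fun=> w0) ?lim_cst//.
apply/funext => n; rewrite /euler_at (_ : Num.truncn _ = 0%N)//.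
apply/truncn0Pn; rewrite -ltNge (le_lt_trans _ ltr01)//.
by rewrite pmulr_lle0 ?exprn_gt0.
Qed.

Lemma euler_bounded_le w0 (S T : R) : S <= T ->
  euler_bounded w0 T -> euler_bounded w0 S.
Proof.
move=> ST [N [c bound]]; exists N, c => n k Nn kS; apply: bound => //.
by rewrite (le_trans kS)// ler_wpM2r// exprn_ge0.
Qed.

Lemma euler_lim_lipschitz w0 (T : R) : euler_bounded w0 T ->
  exists2 c, 0 <= c & forall s t, s <= T -> t <= T ->
    `|euler_lim w0 t - euler_lim w0 s| <= c * `|t - s|.
Proof.
(* For [T < 0] the bound is vacuous and [c'] has no sign. *)
move=> eT; have [N [c' bound]] := eT; pose c := Num.max 0 c'.
have c0 : 0 <= c by rewrite le_max lexx.
exists c => // s t; wlog st : s t / s <= t => [wl sT tT|_ tT].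
  have [st|/ltW ts] := leP s t; first exact: wl.
  by rewrite distrC (distrC t) wl.
wlog s0 : s st / 0 <= s => [wl|].
  have [s0|/ltW s0] := leP 0 s; first exact: wl.
  rewrite (_ : euler_lim w0 s = euler_lim w0 0); last by rewrite !euler_lim_le0.
  have [t0|/ltW t0] := leP 0 t.
    rewrite (le_trans (wl 0 _ _))// ler_wpM2l//.
    by rewrite !ger0_norm ?subr_ge0//; lra.
  by rewrite !(euler_lim_le0 _)// subrr normr0 mulr_ge0.
have t0 := le_trans s0 st; have sT := le_trans st tT.
rewrite ger0_norm ?subr_ge0// mulrC -[leRHS]mulr1.
have lhs : `|euler_at w0 n t - euler_at w0 n s| @[n --> \oo] -->
    `|euler_lim w0 t - euler_lim w0 s|.
  by apply: cvg_norm; apply: cvgB; apply: (@euler_at_cvg _ T) => //; rewrite ?t0 ?s0.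
have rhs : ((t - s + 2 ^- n) * c) @[n --> \oo] --> (t - s + 0) * c.
  by apply: cvgMl; apply: cvgD; [exact: cvg_cst|exact: pow2_cvg0].
rewrite mulr1 -[t - s]addr0; apply: ler_cvg_to lhs rhs _.
exists N => // n /= Nn; apply: euler_at_increment => //; first by rewrite s0.
move=> k kt; rewrite (le_trans (bound n k Nn _)) ?le_max ?lexx ?orbT//.
by rewrite (le_trans kt)// ler_wpM2r// exprn_ge0.
Qed.

Lemma truncn_pow2_cvg (t : R) : 0 <= t ->
  (Num.truncn (t * 2 ^+ n))%:R * 2 ^- n @[n --> \oo] --> t.
Proof.
move=> t0; apply: (@squeeze_cvgr _ _ _ _ (fun n => t - 2 ^- n) (fun=> t)).
- by near=> n; exact: truncn_pow2_itv.
- by rewrite -[X in _ --> X]subr0; apply: cvgB; [exact: cvg_cst|exact: pow2_cvg0].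
- exact: cvg_cst.
Unshelve. all: end_near. Qed.

(** Between times [a] and [b] fine schemes stay so close to the limit at [t] that, by strong-weak
    continuity, [ip (A _) z] is within [e] of its value there; summing and letting the step vanish
    gives the bound. Allowing [t] to be either endpoint serves left, right and initial derivatives
    alike. *)
Lemma euler_lim_weak_increment w0 (T t e : R) z :
  euler_bounded w0 T -> 0 <= t < T -> 0 < e ->
  exists2 d : R, 0 < d & forall a b, 0 <= a <= t -> t <= b -> b - a < d ->
    `|ip (euler_lim w0 b - euler_lim w0 a) z +
      (b - a) * ip (A (euler_lim w0 t)) z| <= (b - a) * e.
Proof.
move=> eT /andP[t0 tT] e0; have [N [c' bound']] := eT; pose c := Num.max 0 c'.
have c0 : 0 <= c by rewrite le_max lexx.
have {}bound n k : (N <= n)%N -> k%:R <= T * 2 ^+ n -> `|A (euler w0 n k)| <= c.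
  by move=> Nn kT; rewrite (le_trans (bound' n k Nn kT))// le_max lexx orbT.
set x := euler_lim w0 t; set p := ip _ z.
have [d0 d00 demi] := monotone_demicontinuous x z e0.
(* The schemes move by at most [(b - a + 2 ^- n) * c <= 2 * d * c < d0 / 2]; the other [d0 / 2]
   covers the convergence at [t]. *)
pose d := d0 / (4 * (c + 1)).
have c1 : 0 < 4 * (c + 1) by rewrite mulr_gt0// ltr_wpDl.
have dd : 0 < d by rewrite divr_gt0.
exists (Num.min (T - t) d); first by rewrite lt_min subr_gt0 tT.
move=> a b /andP[a0 a_t] tb; rewrite lt_min => /andP[baT bad].
have b0 := le_trans t0 tb; have bT : b < T by lra.
pose k (s : R) n := Num.truncn (s * 2 ^+ n).
have near_bound : \forall n \near \oo,
    `|ip (euler_at w0 n b - euler_at w0 n a) z +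
      ((k b n)%:R * 2 ^- n - (k a n)%:R * 2 ^- n) * p| <=
    ((k b n)%:R * 2 ^- n - (k a n)%:R * 2 ^- n) * e.
  have xt : euler_at w0 n t @[n --> \oo] --> x.
    by apply: (@euler_at_cvg _ T) => //; rewrite t0 ltW.
  have d2 : 0 < d0 / 2 by rewrite divr_gt0.
  have /cvgr0Pnorm_le/(_ _ dd) := pow2_cvg0.
  move/cvgrPdist_lt: xt => /(_ _ d2) near1 near2.
  near=> n.
  have Nn : (N <= n)%N by near: n; exists N.
  have n0 : (0 : R) < 2 ^+ n by rewrite exprn_gt0.
  have hd : (2 ^- n : R) <= d.
    by rewrite (le_trans (ler_norm _))//; near: n.
  have xd : `|x - euler_at w0 n t| < d0 / 2 by near: n.
  have at_ : (k a n <= k t n)%N by apply: le_truncn; rewrite ler_pM2r.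
  have tb_ : (k t n <= k b n)%N by apply: le_truncn; rewrite ler_pM2r.
  have ab := leq_trans at_ tb_.
  have := @euler_ip_increment w0 n (k a n) (k b n - k a n) z p e.
  rewrite subnKC// natrB// -mulrBl; apply=> j /andP[aj jb].
  rewrite -ipNl -ipDl demi//.
  have bd l : (l < k b n)%N -> `|A (euler w0 n l)| <= c.
    move=> lb; apply: bound => //; rewrite (@le_trans _ _ (b * 2 ^+ n))//.
      by rewrite -truncn_ge_nat ?(ltnW lb)// mulr_ge0// ltW.
    by rewrite ler_pM2r// ltW.
  have : `|euler w0 n j - euler_at w0 n t| <= 2 * d * c.
    rewrite (le_trans (euler_increment c0 _))//.
      by move=> l; rewrite leq_max => /orP[] lj; apply: bd;
        apply: leq_trans lj _ => //; exact: ltnW.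
    rewrite ler_wpM2r// (@le_trans _ _ (((k b n)%:R - (k a n)%:R) * 2 ^- n))//.
      rewrite ler_wpM2r ?invr_ge0 ?(ltW n0)//.
      have {}at_ : ((k a n)%:R : R) <= (k t n)%:R by rewrite ler_nat.
      have {}tb_ : ((k t n)%:R : R) <= (k b n)%:R by rewrite ler_nat.
      have {}aj : ((k a n)%:R : R) <= j%:R by rewrite ler_nat.
      have {}jb : (j%:R : R) <= (k b n)%:R by rewrite ler_nat ltnW.
      by rewrite -/(k t n) ler_norml; apply/andP; split; lra.
    have /andP[_ ub] := truncn_pow2_itv n b0.
    have /andP[lb _] := truncn_pow2_itv n a0.
    by rewrite mulrBl; lra.
  have dE : d * (4 * (c + 1)) = d0 by rewrite /d divfK// gt_eqF.
  rewrite distrC in xd => le2; rewrite (_ : _ - _ = euler w0 n j -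
    euler_at w0 n t + (euler_at w0 n t - x)); last by rewrite addrA subrK.
  by rewrite (le_lt_trans (ler_normD _ _))//; lra.
have lhs : ((k b n)%:R * 2 ^- n - (k a n)%:R * 2 ^- n) @[n --> \oo] --> b - a.
  by apply: cvgB; exact: truncn_pow2_cvg.
have cvgb : euler_at w0 n b @[n --> \oo] --> euler_lim w0 b.
  by apply: (@euler_at_cvg _ T) => //; rewrite b0 ltW.
have cvga : euler_at w0 n a @[n --> \oo] --> euler_lim w0 a.
  by apply: (@euler_at_cvg _ T) => //; rewrite a0 (le_trans a_t)// ltW.
apply: ler_cvg_to near_bound.
  apply: cvg_norm; apply: cvgD; last exact: cvgMl lhs.
  by apply: cvg_ip; exact: cvgB.
exact: cvgMl lhs.
Unshelve. all: end_near. Qed.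

(** * Weak solutions on bounded intervals and their contraction *)

(** The bounded interval lets the contraction estimate apply to the Euler limit before global
    existence is known. *)
Definition weak_solution (T : R) (w : R -> H) :=
  {within `[0, T], continuous w} /\
  forall z t, 0 < t < T ->
    is_derive t 1 (fun s => ip (w s) z) (- ip (A (w t)) z).

(** By continuity [w] stays near [t] in a ball where [A] is bounded by [c]. The mean value theorem
    is applied to each [ip (w _) z]; the intermediate time depends on [z] but [c] does not, so
    duality gives a norm bound. *)
Lemma weak_solution_lipschitz (T t : R) w : weak_solution T w -> 0 < t < T ->
  exists L : R, \forall s \near t, `|w s - w t| <= L * `|s - t|.
Proof.
move=> [wc wd] tT; have [r [c [r0 Ac]]] := monotone_locally_bounded (w t).
have c0 : 0 <= c by rewrite (le_trans _ (Ac (w t) _))// subrr normr0 ltW.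
exists c; have /nbhs_ballP[d /= d0 dP] :
    \forall s \near t, (0 < s < T) /\ `|w s - w t| <= r.
  have tI : t \in `]0, T[ by rewrite in_itv.
  have wt : {for t, continuous w}.
    have : {within `]0, T[, continuous w}.
      by apply: continuous_subspaceW wc => s /=; exact: subset_itv_oo_cc.
    by rewrite continuous_open_subspace//; apply; rewrite inE.
  near=> s; split.
    by have : s \in `]0, T[ by near: s; exact: near_in_itvoo; rewrite in_itv.
  by rewrite distrC; near: s; move/cvgrPdist_le: wt; apply.
near=> s.
have sd : `|t - s| < d by near: s; exists d.
have segment u : Num.min s t <= u <= Num.max s t -> (0 < u < T) /\ `|w u - w t| <= r.
  move=> /andP[su ut]; apply: dP; rewrite /ball/=.
  move: sd su ut; rewrite ltr_norml ltr_norml le_max ge_min.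
  by move=> /andP[? ?] /orP[?|?] /orP[?|?]; apply/andP; split; lra.
apply: norm_le_dual => [|z]; first by rewrite mulr_ge0.
rewrite ipDl ipNl.
wlog st : / Num.min s t <= Num.max s t by apply; rewrite ge_min !le_max lexx.
have [u|u|u uI] := MVT_segment (f := fun s => ip (w s) z)
  (df := fun s => - ip (A (w s)) z) st.
- move=> /subset_itv_oo_cc; rewrite in_itv/= => /segment[uT _]; exact: wd.
- apply: derivable_within_continuous => x; rewrite in_itv/= => /segment[xT _].
  by have [] := wd z _ xT.
move: uI; rewrite in_itv/= => /segment[_ /Ac Au] incr.
rewrite (le_trans (ler_norm _))//.
have -> : `|ip (w s) z - ip (w t) z| = `|ip (A (w u)) z| * `|s - t|.
  have [st'|st'] := leP s t.
    move: incr; rewrite (min_idPl st') (max_idPr st') distrC => ->.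
    by rewrite normrM normrN (distrC t).
  move: incr; rewrite (min_idPr (ltW st')) (max_idPl (ltW st')) => ->.
  by rewrite normrM normrN.
rewrite mulrAC ler_wpM2r// (le_trans (ip_abs_le_norm _ _))//.
by rewrite ler_wpM2r.
Unshelve. all: end_near. Qed.

(* [|d s|^2] is affine in the weakly differentiable [ip (d s) (d t)] up to
   [|d s - d t|^2], which is [O(|s - t|^2)]. *)
Lemma is_derive_sqr_dist (T t : R) w v :
  weak_solution T w -> weak_solution T v -> 0 < t < T ->
  is_derive t 1 (fun s => `|w s - v s| ^+ 2 : R)
    (- 2 * ip (A (w t) - A (v t)) (w t - v t)).
Proof.
move=> ws vs tT; pose d s := w s - v s.
have [L1 L1P] := weak_solution_lipschitz ws tT.
have [L2 L2P] := weak_solution_lipschitz vs tT.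
have quad : is_derive t 1 (fun s => `|d s - d t| ^+ 2 : R) 0.
  apply: is_derive1_bound => e e0; rewrite subrr normr0.
  pose L := `|L1| + `|L2| + 1.
  have L0 : 0 < L by rewrite ltr_wpDl// addr_ge0.
  have eL : 0 < e / L ^+ 2 by rewrite divr_gt0 ?exprn_gt0.
  near=> s; rewrite expr0n/= mulr0 !subr0 ger0_norm ?sqr_ge0//.
  have le1 : `|d s - d t| <= L * `|s - t|.
    have l1 : `|w s - w t| <= L1 * `|s - t| by near: s.
    have l2 : `|v s - v t| <= L2 * `|s - t| by near: s.
    rewrite (_ : d s - d t = (w s - w t) - (v s - v t)); last first.
      by rewrite /d !opprB addrACA [RHS]addrACA (addrC (- v s)).
    rewrite (le_trans (ler_normB _ _))// (le_trans (lerD l1 l2))//.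
    rewrite -mulrDl ler_wpM2r//; have := ler_norm L1; have := ler_norm L2.
    by rewrite /L; lra.
  have le2 : `|s - t| <= e / L ^+ 2.
    rewrite distrC ltW//; near: s.
  rewrite expr2 (le_trans (ler_pM (normr_ge0 _) (normr_ge0 _) le1 le1))//.
  rewrite mulrACA -expr2 mulrA.
  by rewrite ler_wpM2r// -ler_pdivlMl ?exprn_gt0// mulrC.
have [_ /(_ (d t) t tT) dw] := ws; have [_ /(_ (d t) t tT) dv] := vs.
have -> : (fun s => `|w s - v s| ^+ 2) =
    (2 *: ((fun s => ip (w s) (d t)) - (fun s => ip (v s) (d t))) -
     cst (`|d t| ^+ 2)) + (fun s => `|d s - d t| ^+ 2).
  apply/funext => s; rewrite -/(d s) !fctE /= [in RHS](sqr_normB (d s)).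
  have -> : ip (d s) (d t) = ip (w s) (d t) - ip (v s) (d t).
    by rewrite -ipNl -ipDl.
  by rewrite /GRing.scale/=; ring.
by apply: is_derive_eq; rewrite -/(d t) /GRing.scale/= ipDl ipNl; ring.
Unshelve. all: end_near. Qed.

(** Gronwall: the squared distance times [expR (2 * k * s)] is nonincreasing. The case [k = 0]
    serves the continuation argument, [k > 0] uniqueness and decay. *)
Lemma weak_solution_contraction (k T t : R) w v :
  (forall x y, k * `|x - y| ^+ 2 <= ip (A x - A y) (x - y)) ->
  weak_solution T w -> weak_solution T v -> 0 <= t <= T ->
  `|w t - v t| <= expR (- k * t) * `|w 0 - v 0|.
Proof.
move=> A_strong ws vs /andP[t0 tT].
pose phi s : R := expR (2 * k * s) * `|w s - v s| ^+ 2.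
have dphi s : 0 < s < T -> is_derive s 1 phi (expR (2 * k * s) *
    (2 * k * `|w s - v s| ^+ 2 - 2 * ip (A (w s) - A (v s)) (w s - v s))).
  move=> sT; have d1 := is_derive_sqr_dist ws vs sT.
  have d2 : is_derive s 1 (fun s => expR (2 * k * s)) (expR (2 * k * s) * (2 * k)).
    apply: (@is_derive1_comp _ expR (( *:%R (2 * k)) : R -> R)).
    by apply: is_derive_eq; rewrite /GRing.scale/= mulr1.
  apply: (@is_derive_eq _ _ _ phi _ _ _ _ (is_deriveM d2 d1)).
  by rewrite /GRing.scale/=; ring.
have phi_cont : {within `[0, T], continuous phi}.
  have nd : {within `[0, T], continuous (fun s => `|w s - v s|)}.
    have [wc _] := ws; have [vc _] := vs.
    by move=> s; apply: cvg_norm; apply: cvgB; [exact: wc|exact: vc].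
  move=> s; apply: cvgM; last by apply: cvgM; exact: nd.
  apply: continuous_subspaceT => {}s.
  by apply: continuous_comp; [exact: mulrl_continuous|exact: continuous_expR].
have : phi t <= phi 0.
  apply: (@ler0_derive1_le_cc _ phi 0 T) => //.
  - by move=> s; rewrite in_itv/= => /dphi[].
  - move=> s; rewrite in_itv/= => /dphi[ds dE]; rewrite derive1E dE.
    rewrite pmulr_rle0 ?expR_gt0// subr_le0 -mulrA ler_pM2l//.
  - by rewrite in_itv/= t0.
  - by rewrite in_itv/= lexx (le_trans t0).
rewrite /phi mulr0 expR0 mul1r => le1.
rewrite -(@ler_pXn2r _ 2)// ?nnegrE ?mulr_ge0 ?expR_ge0//.
rewrite exprMn -expRM_natl mulNr mulrN expRN ler_pdivlMl ?expR_gt0//.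
by rewrite mulrA.
Qed.

(** * The Euler limit is a weak solution *)

Lemma euler_lim_continuous_at w0 (T t : R) : euler_bounded w0 T -> t < T ->
  {for t, continuous (euler_lim w0)}.
Proof.
move=> /euler_lim_lipschitz[c c0 lip] tT.
apply/cvgrPdist_le => e e0.
have c1 : 0 < c + 1 by rewrite ltr_wpDl.
near=> s.
have sT : s < T by near: s; exact: lt_nbhsl.
rewrite (le_trans (lip _ _ (ltW sT) (ltW tT)))//.
have st : `|t - s| <= e / (c + 1).
  near: s; apply/nbhs_ballP; exists (e / (c + 1)) => /=; first by rewrite divr_gt0.
  by move=> s; rewrite /ball/= => /ltW.
rewrite (@le_trans _ _ ((c + 1) * `|t - s|))//; first by rewrite ler_wpM2r// lerDl.
by rewrite -ler_pdivlMl// mulrC.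
Unshelve. all: end_near. Qed.

Lemma euler_lim_is_derive w0 (T t : R) z : euler_bounded w0 T -> 0 < t < T ->
  is_derive t 1 (fun s => ip (euler_lim w0 s) z) (- ip (A (euler_lim w0 t)) z).
Proof.
move=> eT /andP[t0 tT]; apply: is_derive1_bound => e e0.
have tI : 0 <= t < T by rewrite ltW.
have [d d0 dP] := euler_lim_weak_increment z eT tI e0.
near=> s.
have s0 : 0 < s by near: s; exact: lt_nbhsr.
have std : `|t - s| < d.
  by near: s; apply/nbhs_ballP; exists d.
have [st|/ltW ts] := leP s t.
  have std' : t - s < d by rewrite (le_lt_trans (ler_norm _)).
  have := dP s t; rewrite (ltW s0) st lexx => /(_ isT isT std').
  rewrite (distrC s t) (ger0_norm (_ : 0 <= t - s)) ?subr_ge0//.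
  rewrite (mulrC e); apply: le_trans.
  by rewrite -normrN !ipE le_eqVlt; apply/orP; left; apply/eqP; congr `| _ |; ring.
have std' : s - t < d by rewrite (le_lt_trans (ler_norm _))// distrC.
have := dP t s; rewrite (ltW t0) ts lexx => /(_ isT isT std').
rewrite (ger0_norm (_ : 0 <= s - t)) ?subr_ge0// (mulrC e); apply: le_trans.
by rewrite !ipE le_eqVlt; apply/orP; left; apply/eqP; congr `| _ |; ring.
Unshelve. all: end_near. Qed.

(** The equation is autonomous. The shift [h] allows the limit curve to be compared with its own
    translates. *)
Lemma euler_lim_weak_solution w0 (S T h : R) : euler_bounded w0 T -> 0 <= h ->
  S + h < T -> weak_solution S (fun s => euler_lim w0 (s + h)).
Proof.
move=> eT h0 ST; split=> [|z t /andP[t0 tS]].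
  apply: continuous_in_subspaceT => s; rewrite inE/= in_itv/= => /andP[_ sS].
  apply: continuous_comp; first by apply: cvgD; [exact: cvg_id|exact: cvg_cst].
  by apply: (euler_lim_continuous_at eT); rewrite (le_lt_trans _ ST)// lerD2r.
have d1 : is_derive (t + h) 1 (fun s => ip (euler_lim w0 s) z)
    (- ip (A (euler_lim w0 (t + h))) z).
  by apply: (euler_lim_is_derive _ eT); rewrite ltr_wpDr// (lt_trans _ ST)// ltrD2r.
have d2 : is_derive t 1 (fun s : R => s + h) 1.
  by apply: is_derive_eq; rewrite addr0.
by have := @is_derive1_comp _ _ (fun s => s + h) _ _ _ d1 d2; rewrite mulr1.
Qed.

(** * Continuation to all times *)

Lemma euler_stays_in_ball x y n m (r c : R) :
  (forall y, `|y - x| <= r -> `|A y| <= c) -> 0 <= c -> `|y - x| <= r / 2 ->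
  m%:R * 2 ^- n * c <= r / 2 ->
  `|euler y n m - x| <= r.
Proof.
move=> Ac c0 yx mc; have h0 : 0 <= (2 ^- n : R) by rewrite invr_ge0 exprn_ge0.
(* The path-length bound is the inductive statement: inside the ball each step has length at most
   [2 ^- n * c]. *)
suff : `|euler y n m - y| <= m%:R * 2 ^- n * c.
  move=> le1; rewrite -(subrK y (euler y n m)) -addrA.
  by rewrite (le_trans (ler_normD _ _))//; lra.
elim: m mc => [|m IH] mc; first by rewrite subrr normr0 !mul0r.
have hc : 0 <= 2 ^- n * c by rewrite mulr_ge0.
move: mc; rewrite -(natr1 m) 2!mulrDl mul1r => mc.
have {}/IH IH : m%:R * 2 ^- n * c <= r / 2 by lra.
rewrite [euler y n _]iterS -/(euler y n m) addrAC (le_trans (ler_normB _ _))//.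
rewrite lerD// normrZ ger0_norm// ler_wpM2l//; apply: Ac.
rewrite -(subrK y (euler y n m)) -addrA (le_trans (ler_normD _ _))//; lra.
Qed.

(** At time [T] all fine schemes are within [r / 2] of [x]. Restarted there, they run for a time at
    most [2 * t], namely [t] plus one truncated grid step, and so cannot leave the ball where [A] is
    bounded. *)
Lemma euler_bounded_extend w0 x (T r c t : R) :
  (forall y, `|y - x| <= r -> `|A y| <= c) -> 0 <= c -> 0 <= T ->
  euler_bounded w0 T -> `|euler_lim w0 T - x| < r / 2 ->
  0 < t -> 2 * t * c <= r / 2 -> euler_bounded w0 (T + t).
Proof.
move=> Ac c0 T0 eT ux t0 tc; have [N [c' bound]] := eT.
have cvgT : euler_at w0 n T @[n --> \oo] --> euler_lim w0 T.
  by apply: (euler_at_cvg eT); rewrite T0 lexx.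
have [N1 _ N1P] : \forall n \near \oo, `|euler_at w0 n T - x| <= r / 2.
  have : `|euler_at w0 n T - x| @[n --> \oo] --> `|euler_lim w0 T - x|.
    by apply: cvg_norm; apply: cvgB => //; exact: cvg_cst.
  by move=> /cvgr_le; apply.
have /cvgr0Pnorm_le/(_ _ t0)[N2 _ N2P] := pow2_cvg0.
exists (maxn N (maxn N1 N2)), (Num.max c c') => n k.
rewrite !geq_max => /and3P[Nn N1n N2n] kT.
have n0 : (0 : R) < 2 ^+ n by rewrite exprn_gt0.
have TN0 : 0 <= T * 2 ^+ n by rewrite mulr_ge0// ltW.
rewrite le_max; have [kl|lk] := leqP k (Num.truncn (T * 2 ^+ n)).
  by rewrite bound ?orbT// -truncn_ge_nat.
apply/orP; left; apply: (Ac).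
have := N1P n N1n; rewrite /= /euler_at; set l := Num.truncn _ => lx.
have -> : euler w0 n k = euler (euler w0 n l) n (k - l).
  by rewrite /euler -iterD subnK// ltnW.
apply: (euler_stays_in_ball Ac c0 lx); rewrite (le_trans _ tc)// ler_wpM2r//.
have := N2P n N2n; rewrite /= ger0_norm ?invr_ge0 ?(ltW n0)// => ht.
have /andP[lb _] := truncn_pow2_itv n T0.
rewrite natrB 1?ltnW// mulrBl.
have : k%:R * 2 ^- n <= T + t by rewrite ler_pdivrMr.
by rewrite -/l in lb; lra.
Qed.

(* By contraction, [|u t - u t0| <= |u (t - t0) - u 0|]: the modulus of
   continuity at 0 is valid on the whole of [0, T[. *)
Lemma euler_lim_cvg_at_left w0 (T : R) : 0 < T ->
  (forall S, S < T -> euler_bounded w0 S) -> cvg (euler_lim w0 t @[t --> T^'-]).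
Proof.
move=> T0 eT; apply/cauchy_cvgP; apply: cauchy_exP => e e0.
have : {for 0, continuous (euler_lim w0)}.
  by apply: (euler_lim_continuous_at (eT (T / 2) _)); lra.
move=> /cvgrPdist_lt/(_ _ e0)/nbhs_ballP[d /= d0 dP].
(* The minimum with [T] keeps [t0] nonnegative, and [d / 2] gives [T - t0 < d]. *)
pose t0 := T - Num.min (d / 2) T.
have [min1 min2] : Num.min (d / 2) T <= d / 2 /\ Num.min (d / 2) T <= T.
  by rewrite !ge_min !lexx orbT.
have min0 : 0 < Num.min (d / 2) T by rewrite lt_min T0 divr_gt0.
exists (euler_lim w0 t0).
have t0T : t0 < T by rewrite /t0; lra.
near=> t; rewrite -ball_normE/= distrC.
have tT : t < T by near: t; exact: nbhs_left_lt.
have t0t : t0 < t by near: t; exact: nbhs_left_gt.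
have [S [tS ST]] : exists S, t < S /\ S < T.
  by exists ((t + T) / 2); split; lra.
have t00 : 0 <= t0 by rewrite /t0; lra.
have tt0 : 0 <= t - t0 by lra.
(* The curve and its translate by [t - t0] are compared at time [t0]; the initial gap is that
   between times 0 and [t - t0 < d]. *)
have := weak_solution_contraction (k := 0) (T := t0) (t := t0)
  (w := fun s => euler_lim w0 (s + (t - t0))) (v := fun s => euler_lim w0 (s + 0)).
rewrite /= oppr0 mul0r expR0 mul1r add0r !addr0 (addrC t0) subrK => le1.
rewrite (le_lt_trans (le1 _ _ _ _))//.
- by move=> x y; rewrite mul0r.
- by apply: euler_lim_weak_solution (eT S ST) tt0 _; lra.
- by apply: euler_lim_weak_solution (eT S ST) (lexx _) _; lra.
- by rewrite t00 lexx.
- by rewrite distrC; apply: dP; rewrite /ball/= sub0r normrN ger0_norm// /t0; lra.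
Unshelve. all: end_near. Qed.

(** Otherwise the times of boundedness have a finite supremum, where the curve has a left limit [x].
    The extension length [d] depends only on [x], so extending from a time closer than [d] to the
    supremum goes beyond it. *)
Lemma euler_bounded_all w0 (T : R) : euler_bounded w0 T.
Proof.
apply: contrapT => nT.
pose E : set R := [set S | euler_bounded w0 S].
have E0 : E 0.
  exists 0%N, `|A w0| => n k _; rewrite mul0r lern0 => /eqP ->.
  by rewrite lexx.
have EsupT : has_sup E.
  split; first by exists 0.
  exists T => S ES; rewrite leNgt; apply/negP => TS.
  by apply: nT; apply: euler_bounded_le ES; exact: ltW.
have below S : S < sup E -> euler_bounded w0 S.
  by move=> /(sup_gt EsupT.1)[S' ES' SS']; apply: euler_bounded_le ES'; exact: ltW.
have extend x : exists r d : R, [/\ 0 < r, 0 < d & forall S, 0 <= S -> E S ->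
    `|euler_lim w0 S - x| < r -> E (S + d)].
  have [r [c [r0 Ac]]] := monotone_locally_bounded x.
  have c0 : 0 <= c by rewrite (le_trans _ (Ac x _))// subrr normr0 ltW.
  have c1 : 0 < 4 * (c + 1) by rewrite mulr_gt0// ltr_wpDl.
  (* With this length the distance travelled is at most [r / 2 * (c / (c + 1))], hence at most
     [r / 2]. *)
  exists (r / 2), (r / (4 * (c + 1))); split; rewrite ?divr_gt0// => S S0 ES Sx.
  apply: (euler_bounded_extend Ac c0 S0 ES Sx); first by rewrite divr_gt0.
  have c2 : 0 < c + 1 by rewrite ltr_wpDl.
  rewrite (_ : _ * c = r / 2 * (c / (c + 1))); last by field; rewrite gt_eqF.
  by rewrite ler_piMr ?divr_ge0 ?(ltW r0)// ler_pdivrMr// mul1r lerDl.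
have sup0 : 0 < sup E.
  have [r [d [r0 d0 /(_ 0 (lexx _) E0)]]] := extend w0.
  rewrite (euler_lim_le0 w0 (lexx 0)) subrr normr0 add0r => /(_ r0) Ed.
  by rewrite (lt_le_trans d0)// ub_le_sup//; case: EsupT.
have /cvg_ex[/= x ux] := euler_lim_cvg_at_left sup0 below.
have [r [d [r0 d0 ext]]] := extend x.
have [S [S0 SE Sd Sx]] : exists S,
    [/\ 0 <= S, S < sup E, sup E < S + d & `|euler_lim w0 S - x| < r].
  move/cvgrPdist_lt: ux => /(_ _ r0) ux.
  suff : \forall S \near (sup E)^'-,
      [/\ 0 <= S, S < sup E, sup E < S + d & `|euler_lim w0 S - x| < r].
    by move=> /filter_ex.
  near=> S; split.
  - by rewrite ltW//; near: S; exact: nbhs_left_gt.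
  - by near: S; exact: nbhs_left_lt.
  - by rewrite -ltrBlDr; near: S; apply: nbhs_left_gt; rewrite ltrBlDr ltrDl.
  - by rewrite distrC; near: S.
have /ub_le_sup : E (S + d) by apply: ext => //; exact: below.
by move=> /(_ EsupT.2); rewrite leNgt Sd.
Unshelve. all: end_near. Qed.

Lemma euler_lim_solution w0 (S h : R) : 0 <= h ->
  weak_solution S (fun s => euler_lim w0 (s + h)).
Proof.
move=> h0; apply: (euler_lim_weak_solution (euler_bounded_all w0 (S + h + 1))) => //.
by rewrite ltrDl.
Qed.

Lemma euler_lim_continuous w0 : continuous (euler_lim w0).
Proof.
move=> t; apply: (euler_lim_continuous_at (euler_bounded_all w0 (t + 1))).
by rewrite ltrDl.
Qed.

Lemma euler_lim_is_derive_right w0 z :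
  h^-1 * (ip (euler_lim w0 h) z - ip (euler_lim w0 0) z) @[h --> 0^'+] -->
    - ip (A (euler_lim w0 0)) z.
Proof.
apply/cvgrPdist_le => e e0.
have t01 : 0 <= (0 : R) < 1 by rewrite lexx ltr01.
have [d d0 dP] := euler_lim_weak_increment z (euler_bounded_all w0 1) t01 e0.
near=> h.
have h0 : 0 < h by [].
have hd : h < d by near: h; exact: nbhs_right_lt.
have := dP 0 h; rewrite lexx subr0 => /(_ isT (ltW h0) hd).
rewrite -(ler_pM2l (_ : 0 < h^-1)) ?invr_gt0// mulKf ?gt_eqF//.
rewrite -{1}(gtr0_norm (_ : 0 < h^-1)) ?invr_gt0// -normrM mulrDr mulKf ?gt_eqF//.
by rewrite -normrN !ipE; congr (`| _ | <= _); ring.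
Unshelve. all: end_near. Qed.

(** * Strong monotonicity: uniqueness, semigroup property, stationary point *)

Section StronglyMonotone.
Variable k : R.
Hypothesis k_gt0 : 0 < k.
Hypothesis A_strong : forall x y, k * `|x - y| ^+ 2 <= ip (A x - A y) (x - y).

Lemma weak_solution_unique (T : R) w v :
  weak_solution T w -> weak_solution T v -> w 0 = v 0 -> forall t, 0 <= t <= T -> w t = v t.
Proof.
move=> ws vs wv0 t tT; apply/eqP; rewrite -subr_eq0 -normr_le0.
rewrite (le_trans (weak_solution_contraction A_strong ws vs tT))//.
by rewrite wv0 subrr normr0 mulr0.
Qed.

(** The translated and the restarted curves are weak solutions with the same initial value. *)
Lemma euler_lim_semigroup w0 (s t : R) : 0 <= s -> 0 <= t ->
  euler_lim w0 (t + s) = euler_lim (euler_lim w0 s) t.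
Proof.
move=> s0 t0.
have := weak_solution_unique (euler_lim_solution w0 t s0)
  (euler_lim_solution (euler_lim w0 s) t (lexx 0)).
rewrite add0r addr0 (euler_lim_le0 (euler_lim w0 s) (lexx 0)).
by move=> /(_ erefl t); rewrite addr0 t0 lexx; exact.
Qed.

Lemma euler_lim_contraction x y (t : R) : 0 <= t ->
  `|euler_lim x t - euler_lim y t| <= expR (- k * t) * `|x - y|.
Proof.
move=> t0; have := weak_solution_contraction A_strong
  (euler_lim_solution x t (lexx 0)) (euler_lim_solution y t (lexx 0)).
move=> /(_ t); rewrite t0 lexx !addr0 !(euler_lim_le0 _ (lexx 0)).
exact.
Qed.

(* The time-one map is a strict contraction; its fixed point is fixed by the
   whole flow, since the flow commutes with the time-one map. *)
Lemma euler_lim_stationary :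
  exists2 p, A p = 0 & forall t : R, 0 <= t -> euler_lim p t = p.
Proof.
have q1 : expR (- k * 1) < 1 by rewrite mulr1 expR_lt1 oppr_lt0.
have [p _ pE] : exists2 p, [set: H] p & p = euler_lim p 1.
  pose f : {fun [set: H] >-> [set: H]} :=
    mkfun_fun (fun x _ => I : [set: H] (euler_lim x 1)).
  apply: (@banach_fixed_point _ _ _ f) => //; last by exists 0.
  exists (NngNum (expR_ge0 (- k * 1))); split=> // -[x y] _ /=.
  exact: euler_lim_contraction.
have pfix t : 0 <= t -> euler_lim p t = p.
  move=> t0; apply/eqP; rewrite -subr_eq0 -normr_le0.
  have := euler_lim_contraction (euler_lim p t) p ler01.
  rewrite -euler_lim_semigroup// (addrC 1) euler_lim_semigroup// -pE.
  rewrite -subr_gt0 in q1; move=> le1; rewrite -(pmulr_rle0 _ q1).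
  by rewrite mulrBl mul1r subr_le0.
exists p => //; apply/eqP; rewrite -normr_le0 -(@ler_pXn2r _ 2)// ?nnegrE//.
rewrite ip_norm expr0n/=; apply/ler_addgt0Pr => e e0; rewrite add0r.
have t01 : 0 <= (0 : R) < 1 by rewrite lexx ltr01.
(* Testing with [z = A p] along the constant curve, the increment vanishes and there remains
   [ip (A p) (A p) <= e]. *)
have [d d0 dP] := euler_lim_weak_increment (A p) (euler_bounded_all p 1) t01 e0.
have d2 : 0 < d / 2 by rewrite divr_gt0.
have := dP 0 (d / 2); rewrite lexx subr0 => /(_ isT (ltW d2)).
rewrite !pfix ?(ltW d2)// subrr ip0l add0r => /(_ _)/(le_trans (ler_norm _)).
by rewrite ler_pM2l//; apply; lra.
Qed.

End StronglyMonotone.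
End MonotoneOperator.
End InnerProduct.

(** * The Cauchy problem for the regularized operator *)

Unset Implicit Arguments.

Theorem theorem2 (R : realType) (H : completeNormedModType R)
    (ip : {dot H for idfun}) (ip_norm : induces_norm ip)
    (B : H -> H) (B_mono : monotone_operator ip B)
    (B_hemi : hemicontinuous ip B)
    (eps : R) (eps_gt0 : 0 < eps) (w0 : H) :
  exists w : R -> H,
    [/\ global_weak_solution ip B eps w0 w,
        forall w' : R -> H, global_weak_solution ip B eps w0 w' ->
          forall t : R, 0 <= t -> w' t = w t
      & exists winf : H,
          w t @[t --> +oo] --> winf /\ B winf + eps *: winf = 0].
Proof.
pose A u := B u + eps *: u.
have A_strong x y : eps * `|x - y| ^+ 2 <= ip (A x - A y) (x - y).
  rewrite /A opprD addrACA -scalerBr ipDl ipZl -(ip_norm (x - y)) lerDr.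
  exact: B_mono.
have A_mono : monotone_operator ip A.
  by move=> x y; rewrite (le_trans _ (A_strong x y))// mulr_ge0 ?sqr_ge0// ltW.
have A_hemi : hemicontinuous ip A.
  move=> u v z.
  (* The term added by [eps] is affine in [s]. *)
  rewrite (_ : (fun s => _) = (fun s => ip (B (u + s *: v)) z +
      (eps * ip u z + (eps * ip v z) * s))); last first.
    by apply/funext => s; rewrite /A !ipE; ring.
  move=> s; apply: cvgD; first exact: B_hemi.
  by apply: cvgD; [exact: cvg_cst|exact: mulrl_continuous].
pose w x := euler_lim A x.
have sol : global_weak_solution ip B eps w0 (w w0).
  split=> [||z t t0|z].
  - exact: euler_lim_le0.
  - apply: continuous_subspaceT => t.
    exact: (euler_lim_continuous ip_norm A_mono A_hemi).
  - have tt : 0 < t < t + 1 by rewrite t0 ltrDl ltr01.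
    exact: (euler_lim_is_derive ip_norm A_mono A_hemi _
      (euler_bounded_all ip_norm A_mono A_hemi w0 (t + 1))).
  - exact: (euler_lim_is_derive_right ip_norm A_mono A_hemi).
(* Uniqueness on each bounded interval thus transfers to global solutions. *)
have restrict v T : global_weak_solution ip B eps w0 v -> weak_solution ip A T v.
  move=> [_ vc vd _]; split=> [|z t /andP[t0 _]]; last exact: vd.
  by apply: continuous_subspaceW vc => s; rewrite /= !in_itv/= => /andP[->].
have [p Ap pfix] := euler_lim_stationary ip_norm A_mono A_hemi eps_gt0 A_strong.
exists (w w0); split=> //.
  move=> v vsol t t0.
  have tt : 0 <= t <= t by rewrite t0 lexx.
  have := weak_solution_unique ip_norm A_mono A_strong
    (restrict v t vsol) (restrict _ t sol).
  apply => //; case: vsol => -> _ _ _.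
  by case: sol.
exists p; split=> //.
apply/subr_cvg0; apply: norm_cvg0.
(* The curve started at [p] is constant, so contraction gives exponential convergence to [p] at rate
   [eps]. *)
apply: (@squeeze_cvgr _ _ _ _ (fun=> 0)
    (fun t => expR (- (eps * t)) * `|w0 - p|)); last 2 first.
- exact: cvg_cst.
- rewrite -(mul0r `|w0 - p|); apply: cvgMl.
  by apply: (cvg_comp (fun t => eps * t) _ (gt0_cvgMry eps_gt0 _) (@cvgr_expR R)).
near=> t; rewrite normr_ge0/= -mulNr -[p in leLHS](pfix t).
  by apply: (euler_lim_contraction ip_norm A_mono A_hemi A_strong).
by near: t; exact: nbhs_pinfty_ge.
Unshelve. all: end_near. Qed.
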